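(* The configuration space $\mathfrak{ET}=\mathcal{ET}/G$ of $G$-equivalence classes of equidistant triples in the Heisenberg group $\mathfrak{H}$ is in bijection with the hypersurface $\mathcal{E}$ of $\mathbb{R}^3$ defined by $$\mathcal{E}=\left\{(a,b,c)\in[-2\pi/3,2\pi/3]^3\;:\;\cos a+\cos b+\cos c=\tfrac{3}{2}\right\}.$$
   Context: The Heisenberg group $\mathfrak{H}$ is $\mathbb{C}\times\mathbb{R}$ with group law $(z,t)\star(w,s)=(z+w,\,t+s+2\Im(z\overline{w}))$. The Korányi gauge is $|(z,t)|_{\mathfrak H}=\left||z|^2-it\right|^{1/2}$ and the Korányi distance is $d(p,q)=|p^{-1}\star q|_{\mathfrak H}$. An equidistant triple is an ordered triple $P=(p_1,p_2,p_3)$ of pairwise distinct points of $\mathfrak{H}$ with $d(p_1,p_2)=d(p_2,p_3)=d(p_3,p_1)$. The set of equidistant triples is denoted $\mathcal{ET}$. The similarity group $G=\mathrm{Sim}(\mathfrak{H},d)$ is the group of all compositions of left translations $(z,t)\mapsto(w,s)\star(z,t)$ with $(w,s)\in\mathfrak{H}$, rotations $(z,t)\mapsto(ze^{i\phi},t)$ with $\phi\in\mathbb{R}$, and dilations $(z,t)\mapsto(rz,r^2t)$ with $r>0$. It acts diagonally on $\mathcal{ET}$ by $g\cdot(p_1,p_2,p_3)=(g(p_1),g(p_2),g(p_3))$, and $\mathfrak{ET}$ is the quotient of $\mathcal{ET}$ by this action. *)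

(* Defs.v *)
From mathcomp Require Import all_boot all_order all_algebra.
From mathcomp Require Import all_classical all_reals all_analysis.
From mathcomp Require Import complex.

Set Implicit Arguments.
Unset Strict Implicit.
Unset Printing Implicit Defensive.

Import Order.TTheory GRing.Theory Num.Theory.
Import numFieldNormedType.Exports.

Local Open Scope classical_set_scope.
Local Open Scope ring_scope.

Section Heisenberg.
Variable R : realType.

Definition heis : Type := (R[i] * R)%type.

Definition hmul (p q : heis) : heis :=
  (p.1 + q.1, p.2 + q.2 + 2 * complex.Im (p.1 * (q.1)^*%C)).

Definition hone : heis := (0, 0).

Definition hinv (p : heis) : heis := (- p.1, - p.2).

Lemma hmulVp (p : heis) : hmul (hinv p) p = hone.
Proof.
case: p => -[x y] t; rewrite /hmul /hinv /hone /= !addNr add0r.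
by rewrite mulNr mulrN opprK mulNr [y * x]mulrC subrr mulr0.
Qed.

(* [Normc.normc] is the complex modulus, with values in [R]. *)
Definition gauge (p : heis) : R :=
  Num.sqrt (Normc.normc (((Normc.normc p.1) ^+ 2)%:C%C - 'i%C * (p.2)%:C%C)).

Definition kdist (p q : heis) : R := gauge (hmul (hinv p) q).

Definition expi (phi : R) : R[i] := (cos phi +i* sin phi)%C.

Definition translation (w p : heis) : heis := hmul w p.
Definition rotation (phi : R) (p : heis) : heis := (p.1 * expi phi, p.2).
Definition dilation (r : R) (p : heis) : heis := (r%:C%C * p.1, r ^+ 2 * p.2).

(* Finite compositions of the generators. The identity is [translation hone],
   and the generators are closed under inverses, so this is a group. *)
Inductive similarity : (heis -> heis) -> Prop :=
| sim_translation w : similarity (translation w)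
| sim_rotation phi : similarity (rotation phi)
| sim_dilation r : 0 < r -> similarity (dilation r)
| sim_comp g h : similarity g -> similarity h -> similarity (g \o h).

Definition triple : Type := (heis * heis * heis)%type.

Definition equidistant_triples : set triple :=
  [set P | let: (p1, p2, p3) := P in
    [/\ p1 <> p2, p2 <> p3, p3 <> p1,
        kdist p1 p2 = kdist p2 p3 & kdist p2 p3 = kdist p3 p1]].

Definition diag_act (g : heis -> heis) (P : triple) : triple :=
  let: (p1, p2, p3) := P in (g p1, g p2, g p3).

Definition orbit_of (P : triple) : set triple :=
  [set Q | exists2 g, similarity g & Q = diag_act g P].

(* The quotient of the equidistant triples, as a set of orbits. *)
Definition configuration_space : set (set triple) :=
  orbit_of @` equidistant_triples.

Definition hypersurface : set (R * R * R) :=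
  [set x | let: (a, b, c) := x in
    [/\ - (2 * pi / 3) <= a <= 2 * pi / 3,
        - (2 * pi / 3) <= b <= 2 * pi / 3,
        - (2 * pi / 3) <= c <= 2 * pi / 3 &
        cos a + cos b + cos c = 3 / 2]].

End Heisenberg.

Arguments configuration_space : clear implicits.
Arguments hypersurface : clear implicits.

(* Main.v *)
Require Import Defs.
From mathcomp Require Import all_boot all_order all_algebra.
From mathcomp Require Import all_classical all_reals all_analysis.
From mathcomp Require Import complex ring lra.

(* Write p_i^-1 * p_j = (z_ij, t_ij) and |z_ij|^2 + i t_ij = d^2 e^(i theta_ij),
   where theta_ij lies in [-pi/2, pi/2] and d is the common distance of an
   equidistant triple. The invariants
     a = theta_31 + theta_12, b = theta_12 + theta_23, c = theta_23 + theta_31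
   (arguments of cross-ratios of infinity, p1, p2, p3) determine the theta_ij
   linearly. In terms of z = z_12 and w = z_13, the group law expresses z w^* by
   the theta_ij, and |z w^*|^2 = |z|^2 |w|^2 becomes
   cos a + cos b + cos c = 3/2. Moreover |z|, |w| and z w^* determine (z, w) up
   to a rotation. Conversely, on the hypersurface the numbers
   theta_12 = (a + b - c) / 2, ... lie in [-pi/2, pi/2], so suitable z and w with
   |z|^2 = cos theta_12 and |w|^2 = cos theta_31 exist. *)

Set Implicit Arguments.
Unset Strict Implicit.
Unset Printing Implicit Defensive.

Import Order.TTheory GRing.Theory Num.Theory.

Local Open Scope classical_set_scope.
Local Open Scope ring_scope.

(** * Trigonometric bounds on the hypersurface *)

Section Trigonometry.
Variable R : realType.
Implicit Types a b c x y : R.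

(** Since cos pi = -1, the triple angle formula gives (y + 1)(2y - 1)^2 = 0 for y = cos(pi/3), and y
    is positive. *)
Lemma cos_pi3 : cos (pi / 3) = 1 / 2 :> R.
Proof.
have pi0 := pi_gt0 R.
have c0 : 0 < cos (pi / 3 : R) by apply: cos_gt0_pihalf; lra.
have e3 : cos (pi / 3 *+ 2 + pi / 3 : R) = -1.
  by rewrite -cospi; congr cos; lra.
rewrite cosD cos_mulr2n sin_mulr2n in e3.
have s2 := sin2cos2 (pi / 3 : R).
set y := cos _ in c0 e3 s2 *; set s := sin _ in e3 s2.
have /eqP : (y + 1) * (2 * y - 1) ^+ 2 = 0.
  transitivity (((y ^+ 2 *+ 2 - 1) * y - (y * s) *+ 2 * s + 1)
    + 2 * y * (s ^+ 2 - (1 - y ^+ 2))); first by ring.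
  by rewrite e3 s2 subrr mulr0 addr0 addNr.
by rewrite mulf_eq0 sqrf_eq0 => /orP[] /eqP ?; lra.
Qed.

Lemma cos_2pi3 : cos (2 * pi / 3) = - (1 / 2) :> R.
Proof.
rewrite -cos_pi3 -(opprK (cos _)); congr (- _); rewrite -cosDpi -cosN.
rewrite -(cosD2pi (- _)); congr cos; lra.
Qed.

Lemma cos_geNhalf a : - pi <= a <= pi -> - (1 / 2) <= cos a ->
  - (2 * pi / 3) <= a <= 2 * pi / 3.
Proof.
have pi0 := pi_gt0 R; rewrite -!ler_norml => api.
rewrite -cos_norm -cos_2pi3 leNgt; apply: contraNT; rewrite -ltNge => ha.
by rewrite ltr_cos // in_itv /=; lra.
Qed.

(* With u = (a + b) / 2, the sum of cosines is less than
   2 cos u + 1 - 2 cos^2 u = 3 / 2 - 2 (cos u - 1 / 2)^2 as soon as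
   pi - 2 u < c. *)
Lemma hypersurface_sum a b c :
  a <= 2 * pi / 3 -> b <= 2 * pi / 3 -> c <= 2 * pi / 3 ->
  cos a + cos b + cos c = 3 / 2 -> a + b + c <= pi.
Proof.
have pi0 := pi_gt0 R; move=> ha hb hc e; rewrite leNgt; apply/negP => hs.
pose u := (a + b) / 2; pose v := (a - b) / 2.
have ea : cos a = cos u * cos v - sin u * sin v.
  by rewrite -cosD; congr cos; rewrite /u /v; lra.
have eb : cos b = cos u * cos v + sin u * sin v.
  by rewrite -cosB; congr cos; rewrite /u /v; lra.
have v1 := cos_le1 v; have c1 := cos_le1 c.
have [hu|hu] := leP u (pi / 2).
  have u0 : 0 <= cos u by apply: cos_ge0_pihalf; rewrite /u in hu *; lra.
  have : cos c < cos (pi - u *+ 2).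
    by rewrite ltr_cos ?in_itv /=; rewrite /u in hu *; lra.
  rewrite addrC cosDpi cosN cos_mulr2n => lc.
  have uv : cos u * cos v <= cos u by rewrite ler_piMr.
  have := sqr_ge0 (cos u - 1 / 2); lra.
(* For u beyond pi/2, cos a + cos b = 2 cos u cos v is at most 0, which leaves at most cos c <= 1 <
   3/2. *)
have u0 : cos u <= 0.
  rewrite -(opprK (cos u)) oppr_le0 -cosDpi -cosN -(cosD2pi (- _)).
  by apply: cos_ge0_pihalf; rewrite /u in hu *; lra.
have v0 : 0 <= cos v by apply: cos_ge0_pihalf; rewrite /u /v in hu *; lra.
have := mulr_le0_ge0 u0 v0; lra.
Qed.

Lemma expi_surj x y : x ^+ 2 + y ^+ 2 = 1 -> exists phi, expi phi = (x +i* y)%C.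
Proof.
move=> e.
have x1 : -1 <= x <= 1 by have := sqr_ge0 y; nra.
have := sin_acos x1; rewrite -e addrC addKr sqrtr_sqr => sE.
have cE : cos (acos x) = x by apply: acosK; rewrite in_itv.
have [y0|y0] := leP 0 y.
  by exists (acos x); rewrite /expi cE sE ger0_norm.
by exists (- acos x); rewrite /expi cosN sinN cE sE ltr0_norm // opprK.
Qed.

End Trigonometry.

(** * Polar coordinates: gauge and angle *)

Section Polar.
Variable R : realType.
Implicit Types (p q s : heis R) (r phi theta : R).

Definition sqm p : R := Normc.normc p.1 ^+ 2.

Lemma normc_ge0 (z : R[i]) : 0 <= Normc.normc z.
Proof. by case: z => x y; exact: sqrtr_ge0. Qed.

Lemma normc_sqr (z : R[i]) :
  Normc.normc z ^+ 2 = complex.Re z ^+ 2 + complex.Im z ^+ 2.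
Proof. by case: z => x y; rewrite sqr_sqrtr // addr_ge0 ?sqr_ge0. Qed.

Lemma sqmE p : sqm p = complex.Re p.1 ^+ 2 + complex.Im p.1 ^+ 2.
Proof. exact: normc_sqr. Qed.

Lemma sqm_ge0 p : 0 <= sqm p.
Proof. exact: sqr_ge0. Qed.

Lemma gauge_ge0 p : 0 <= gauge p.
Proof. exact: sqrtr_ge0. Qed.

Lemma gauge_sqr p : gauge p ^+ 2 = Num.sqrt (sqm p ^+ 2 + p.2 ^+ 2).
Proof.
rewrite sqr_sqrtr; last exact: normc_ge0.
rewrite /Normc.normc /= !(mul0r, mul1r, mulr0, subr0, oppr0, addr0, add0r).
by rewrite sqrrN.
Qed.

Lemma gauge_pow4 p : (gauge p ^+ 2) ^+ 2 = sqm p ^+ 2 + p.2 ^+ 2.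
Proof. by rewrite gauge_sqr sqr_sqrtr // addr_ge0 ?sqr_ge0. Qed.

Lemma gauge_eq0 p : gauge p = 0 -> p = hone R.
Proof.
move=> g0; have := gauge_pow4 p; rewrite g0 expr0n /= expr0n /=.
move/esym/eqP; rewrite paddr_eq0 ?sqr_ge0 // !sqrf_eq0.
by case: p {g0} => z t /andP[/= /eqP/Normc.eq0_normc /= -> /eqP ->].
Qed.

(* The angle theta in [-pi/2, pi/2] such that |z|^2 + i t is equal to
   |(z, t)|_H^2 e^(i theta). *)
Definition angle p : R := asin (p.2 / gauge p ^+ 2).

(** |t| is at most the squared gauge by [gauge_pow4]; at the identity the quotient is 0 because the
    inverse of 0 is 0. *)
Lemma angle_argP p : -1 <= p.2 / gauge p ^+ 2 <= 1.
Proof.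
have [g0|g0] := eqVneq (gauge p) 0.
  by rewrite g0 expr0n /= invr0 mulr0 lerN10 ler01.
have gp : 0 < gauge p ^+ 2 by rewrite exprn_gt0 // lt_def g0 gauge_ge0.
rewrite -ler_norml normrM normfV (gtr0_norm gp) ler_pdivrMr // mul1r.
rewrite -(@ler_pXn2r _ 2) ?nnegrE ?(ltW gp) //.
by rewrite gauge_pow4 real_normK ?num_real // lerDr sqr_ge0.
Qed.

Lemma angle_range p : - (pi / 2) <= angle p <= pi / 2.
Proof. by have a1 := angle_argP p; rewrite asin_geNpi2 ?asin_lepi2. Qed.

Lemma cos_angle_ge0 p : 0 <= cos (angle p).
Proof. exact/cos_ge0_pihalf/angle_range. Qed.

Lemma angle_sin p : p.2 = gauge p ^+ 2 * sin (angle p).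
Proof.
rewrite /angle asinK ?in_itv /= ?angle_argP // mulrC.
have [g0|g0] := eqVneq (gauge p) 0; last by rewrite divfK // expf_neq0.
by rewrite (gauge_eq0 g0) /= mul0r mul0r.
Qed.

(** The angle is defined by its sine, which fixes the square of the cosine; its range makes the
    cosine nonnegative. *)
Lemma angle_cos p : sqm p = gauge p ^+ 2 * cos (angle p).
Proof.
apply/eqP; rewrite -(@eqrXn2 _ 2) ?sqm_ge0 //; last first.
  by rewrite mulr_ge0 ?sqr_ge0 ?cos_angle_ge0.
apply/eqP; have := gauge_pow4 p; rewrite (angle_sin p) => e.
rewrite [RHS]exprMn cos2sin2; move: e; set G := gauge p ^+ 2 => e.
by rewrite mulrBr mulr1 -exprMn e addrK.
Qed.

Lemma angle_unique p theta : gauge p != 0 -> - (pi / 2) <= theta <= pi / 2 ->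
  p.2 = gauge p ^+ 2 * sin theta -> angle p = theta.
Proof.
move=> g0 t2 e; rewrite /angle e [_ * sin _]mulrC mulfK ?expf_neq0 //.
by apply: sinK; rewrite in_itv.
Qed.

Lemma gauge_inv p : gauge (hinv p) = gauge p.
Proof.
apply/eqP; rewrite -(@eqrXn2 _ 2) ?gauge_ge0 // !gauge_sqr !sqmE.
by case: p => -[x y] t /=; rewrite !sqrrN.
Qed.

Lemma angle_inv p : gauge p != 0 -> angle (hinv p) = - angle p.
Proof.
move=> g0; apply: angle_unique; rewrite ?gauge_inv //.
  by have := angle_range p; lra.
by rewrite sinN mulrN -angle_sin.
Qed.

Lemma sqm_rotation phi p : sqm (rotation phi p) = sqm p.
Proof.
rewrite !sqmE; case: p => -[x y] t /=.
transitivity ((x ^+ 2 + y ^+ 2) * (cos phi ^+ 2 + sin phi ^+ 2)); first by ring.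
by rewrite cos2Dsin2 mulr1.
Qed.

Lemma sqm_dilation r p : sqm (dilation r p) = r ^+ 2 * sqm p.
Proof. by rewrite !sqmE; case: p => -[x y] t /=; ring. Qed.

Lemma gauge_rotation phi p : gauge (rotation phi p) = gauge p.
Proof.
by apply/eqP; rewrite -(@eqrXn2 _ 2) ?gauge_ge0 // !gauge_sqr sqm_rotation.
Qed.

Lemma gauge_dilation r p : 0 < r -> gauge (dilation r p) = r * gauge p.
Proof.
move=> r0; apply/eqP; rewrite -(@eqrXn2 _ 4) ?mulr_ge0 ?gauge_ge0 ?(ltW r0) //.
rewrite exprMn !(exprM _ 2 2) !gauge_pow4 sqm_dilation /=; apply/eqP; ring.
Qed.

Lemma angle_rotation phi p : angle (rotation phi p) = angle p.
Proof. by rewrite /angle gauge_rotation. Qed.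

Lemma angle_dilation r p : 0 < r -> angle (dilation r p) = angle p.
Proof.
move=> r0; rewrite /angle gauge_dilation //= exprMn -mulf_div divff ?mul1r //.
by rewrite expf_neq0 // gt_eqF.
Qed.

End Polar.

(** * Displacements, their invariance, and the cosine relation *)

Section Displacement.
Variable R : realType.
Implicit Types (p q s x y w : heis R) (r phi theta : R).

(** The left-invariant difference of two points; its gauge is [kdist p q]. *)
Definition displacement p q := hmul (hinv p) q.

Lemma displacement0 q : displacement (hone R) q = q.
Proof.
by case: q => -[x y] t; rewrite /displacement /hmul /hinv /hone /=;
  congr (_, _); [congr (_ +i* _)%C|]; ring.
Qed.

Lemma displacementK p q : hmul p (displacement p q) = q.
Proof.
by case: p q => -[a b] t [[x y] u]; rewrite /displacement /hmul /hinv /=;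
  congr (_, _); [congr (_ +i* _)%C|]; ring.
Qed.

Lemma displacement_eq1 p q : displacement p q = hone R -> q = p.
Proof.
move=> e; rewrite -(displacementK p q) e; case: p {e} => -[a b] t.
by rewrite /hmul /hone /=; congr (_, _); [congr (_ +i* _)%C|]; ring.
Qed.

Lemma displacementC p q : displacement q p = hinv (displacement p q).
Proof.
by case: p q => -[a b] t [[x y] u]; rewrite /displacement /hmul /hinv /=;
  congr (_, _); [congr (_ +i* _)%C|]; ring.
Qed.

Lemma displacement_translation w p q :
  displacement (hmul w p) (hmul w q) = displacement p q.
Proof.
by case: p q w => -[a b] t [[x y] u] [[c d] v];
  rewrite /displacement /hmul /hinv /=;
  congr (_, _); [congr (_ +i* _)%C|]; ring.
Qed.

(** Moving [s] to the identity preserves displacements, so a triple can be studied through the two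
    displacements from its first point. *)
Lemma displacement_displacement s p q :
  displacement (displacement s p) (displacement s q) = displacement p q.
Proof. exact: displacement_translation. Qed.

Lemma displacement_rotation phi p q :
  displacement (rotation phi p) (rotation phi q) =
  rotation phi (displacement p q).
Proof.
case: p q => -[a b] t [[x y] u]; rewrite /displacement /hmul /hinv /rotation /=.
congr (_, _); first by congr (_ +i* _)%C; ring.
transitivity (- t + u + 2 * ((a * y - b * x) * (cos phi ^+ 2 + sin phi ^+ 2))).
  by ring.
by rewrite cos2Dsin2; ring.
Qed.

Lemma displacement_dilation r p q :
  displacement (dilation r p) (dilation r q) = dilation r (displacement p q).
Proof.
by case: p q => -[a b] t [[x y] u];
  rewrite /displacement /hmul /hinv /dilation /=;
  congr (_, _); [congr (_ +i* _)%C|]; ring.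
Qed.

(** Together with [snd_displacement], this recovers the real and imaginary parts of z w^* from the
    polar data of the three displacements. *)
Lemma sqm_displacement p q : sqm (displacement p q) =
  sqm p + sqm q - 2 * complex.Re (p.1 * (q.1)^*%C).
Proof. by rewrite !sqmE; case: p q => -[a b] t [[x y] u] /=; ring. Qed.

Lemma snd_displacement p q : (displacement p q).2 =
  q.2 - p.2 - 2 * complex.Im (p.1 * (q.1)^*%C).
Proof. by case: p q => -[a b] t [[x y] u] /=; ring. Qed.

(** Induction on the generators: translations cancel in a displacement, while rotations and
    dilations are automorphisms and pass through it. *)
Lemma similarity_displacement (g : heis R -> heis R) : similarity g ->
  exists2 r, 0 < r & forall p q,
    gauge (displacement (g p) (g q)) = r * gauge (displacement p q) /\
    angle (displacement (g p) (g q)) = angle (displacement p q).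
Proof.
elim=> [w|phi|r r0|h k _ [r r0 hr] _ [l l0 hl]].
- by exists 1 => // p q; rewrite displacement_translation mul1r.
- exists 1 => // p q.
  by rewrite displacement_rotation gauge_rotation angle_rotation mul1r.
- exists r => // p q.
  by rewrite displacement_dilation gauge_dilation ?angle_dilation.
- exists (r * l) => [|p q]; first exact: mulr_gt0.
  by rewrite /= !(hr _ _).1 !(hr _ _).2 !(hl _ _).1 !(hl _ _).2 mulrA.
Qed.

(** Here [x] and [y] stand for the displacements from p1 to p2 and p3; [y] runs against the cyclic
    order, hence the sign in [t31]. *)
Lemma cosine_relation x y : gauge x != 0 -> gauge y = gauge x ->
  gauge (displacement x y) = gauge x ->
  let t12 := angle x in let t23 := angle (displacement x y) in
  let t31 := - angle y in
  cos (t31 + t12) + cos (t12 + t23) + cos (t23 + t31) = 3 / 2.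
Proof.
move=> g0 gy gd /=; rewrite !cosD !cosN !sinN.
set t1 := angle x; set t2 := angle (displacement x y); set t3 := angle y.
have := sqm_displacement x y; have := snd_displacement x y.
rewrite !angle_cos !angle_sin gy gd -/t1 -/t2 -/t3.
have c1 := cos2Dsin2 t1; have c2 := cos2Dsin2 t2; have c3 := cos2Dsin2 t3.
have : complex.Re (x.1 * (y.1)^*%C) ^+ 2 + complex.Im (x.1 * (y.1)^*%C) ^+ 2
    = sqm x * sqm y.
  rewrite !sqmE; case: (x) (y) => -[a b] t [[c d] u] /=; ring.
rewrite !angle_cos gy -/t1 -/t3.
set G := gauge x ^+ 2; set u := complex.Re _; set v := complex.Im _ => e ev eu.
have G0 : G ^+ 2 != 0 by rewrite !expf_neq0.
have uE : u = G * (cos t1 + cos t3 - cos t2) / 2 by lra.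
have vE : v = G * (sin t3 - sin t1 - sin t2) / 2 by lra.
have /(mulfI G0) :
    G ^+ 2 * ((cos t1 + cos t3 - cos t2) ^+ 2 + (sin t3 - sin t1 - sin t2) ^+ 2) =
    G ^+ 2 * (4 * (cos t1 * cos t3)).
  transitivity (4 * (G * cos t1 * (G * cos t3))); last by ring.
  by rewrite -e uE vE; field.
(* Expanding the squares with cos^2 + sin^2 = 1 leaves 3 equal to twice the sum of the three
   cosines. *)
by move=> ee; nra.
Qed.

(** If [z] is nonzero, [z' / z] is a phase, and cancelling [z] in the product equation forces the
    same phase on [w]. If [z] vanishes, so does [z'], and [w] alone dictates the phase. *)
Lemma common_phase (z w z' w' : R[i]) :
  Normc.normc z = Normc.normc z' -> Normc.normc w = Normc.normc w' ->
  z * w^*%C = z' * w'^*%C ->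
  exists phi, z' = z * expi phi /\ w' = w * expi phi.
Proof.
have unit_circle (u v : R[i]) : u != 0 -> Normc.normc u = Normc.normc v ->
    exists phi, v = u * expi phi.
  move=> u0 e; have : Normc.normc (v / u) = 1.
    rewrite Normc.normcM Normc.normcV -e divff //.
    by apply: contra u0 => /eqP/Normc.eq0_normc ->.
  case E : (v / u) => [a b] /(congr1 (fun c => c ^+ 2)).
  rewrite normc_sqr expr1n => /expi_surj[phi ephi].
  by exists phi; rewrite ephi -E mulrC divfK.
have normc_eq0 (u : R[i]) : Normc.normc 0 = Normc.normc u -> u = 0.
  by rewrite Normc.normc0 => /esym/Normc.eq0_normc.
move=> ez ew e; have [z0|z0] := eqVneq z 0.
  move: ez; rewrite z0 => /normc_eq0 ->.
  have [w0|w0] := eqVneq w 0.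
    by move: ew; rewrite w0 => /normc_eq0 ->; exists 0; rewrite !mul0r.
  have [phi wE] := unit_circle _ _ w0 ew.
  by exists phi; rewrite mul0r.
have [phi zE] := unit_circle _ _ z0 ez; exists phi; split => //.
move: e; rewrite zE -mulrA => /(mulfI z0).
case: w w' {z z' ez ew z0 zE} => [a b] [c d] [/= ea eb].
have {}eb : b = - (cos phi * - d + sin phi * c) by rewrite -eb opprK.
rewrite /expi; congr (_ +i* _)%C.
  transitivity (c * (cos phi ^+ 2 + sin phi ^+ 2)).
    by rewrite cos2Dsin2 mulr1.
  by rewrite ea eb; ring.
transitivity (d * (cos phi ^+ 2 + sin phi ^+ 2)).
  by rewrite cos2Dsin2 mulr1.
by rewrite ea eb; ring.
Qed.

End Displacement.

(** * Equidistant triples and their angle invariants *)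

Section EquidistantTriples.
Variable R : realType.
Implicit Types (p q x y : heis R) (P Q : triple R) (r phi theta : R).

(** Dilating by the ratio of the gauges makes the squared moduli and heights agree, hence also z
    w^*; [common_phase] then supplies the rotation. *)
Lemma pair_similar x y x' y' :
  gauge x != 0 -> gauge y = gauge x -> gauge (displacement x y) = gauge x ->
  gauge x' != 0 -> gauge y' = gauge x' ->
  gauge (displacement x' y') = gauge x' ->
  angle x' = angle x -> angle y' = angle y ->
  angle (displacement x' y') = angle (displacement x y) ->
  exists r phi, [/\ 0 < r, x' = rotation phi (dilation r x)
                         & y' = rotation phi (dilation r y)].
Proof.
move=> g0 gy gd g0' gy' gd' ax ay ad.
have gt0 (p : heis R) : gauge p != 0 -> 0 < gauge p.
  by move=> h; rewrite lt_def h gauge_ge0.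
pose r := gauge x' / gauge x.
have r0 : 0 < r by rewrite divr_gt0 ?gt0.
have rg : r * gauge x = gauge x' by rewrite divfK.
have polar_eq p p' : gauge p = gauge x -> gauge p' = gauge x' ->
    angle p' = angle p ->
    sqm (dilation r p) = sqm p' /\ (dilation r p).2 = p'.2.
  move=> gp gp' a; rewrite !angle_cos !angle_sin angle_dilation //.
  by rewrite gauge_dilation // a gp' gp rg.
have [sx tx] := polar_eq _ _ erefl erefl ax.
have [sy ty] := polar_eq _ _ gy gy' ay.
have [] := polar_eq _ _ gd gd' ad.
rewrite -displacement_dilation !sqm_displacement !snd_displacement.
rewrite sx tx sy ty => sd td.
have normc_eq (z w : R[i]) : Normc.normc z ^+ 2 = Normc.normc w ^+ 2 ->
    Normc.normc z = Normc.normc w.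
  by move/eqP; rewrite eqrXn2 ?normc_ge0 // => /eqP.
have [|phi [zx zy]] := common_phase (normc_eq _ _ sx) (normc_eq _ _ sy).
  by apply/eqP; rewrite eq_complex; apply/andP; split; apply/eqP; lra.
exists r, phi; split=> //; rewrite /rotation -?zx -?zy ?tx ?ty.
  exact: surjective_pairing.
exact: surjective_pairing.
Qed.

(** For a > 0, take z = sqrt a and let w be the conjugate of m divided by sqrt a; for a = 0, m
    vanishes too. *)
Lemma product_conj_surj (a b : R) (m : R[i]) : 0 <= a -> 0 <= b ->
  Normc.normc m ^+ 2 = a * b ->
  exists z w,
    [/\ Normc.normc z ^+ 2 = a, Normc.normc w ^+ 2 = b & z * w^*%C = m].
Proof.
move=> a0 b0; have [->|an0] := eqVneq a 0.
  rewrite mul0r => /eqP; rewrite sqrf_eq0 => /eqP/Normc.eq0_normc ->.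
  exists 0, (Num.sqrt b)%:C%C; rewrite !normc_sqr /= sqr_sqrtr // mul0r.
  by rewrite expr0n !addr0.
have sn0 : Num.sqrt a != 0 by rewrite gt_eqF // sqrtr_gt0 lt_def an0.
have s2 := sqr_sqrtr a0.
case: m => u v; rewrite normc_sqr /= => e.
exists (Num.sqrt a)%:C%C, (u / Num.sqrt a +i* - (v / Num.sqrt a))%C.
rewrite !normc_sqr /= expr0n addr0 s2; split => //.
  by rewrite sqrrN !expr_div_n s2 -mulrDl e mulrC mulKf.
by congr (_ +i* _)%C; field.
Qed.

Lemma unit_polar p theta : - (pi / 2) <= theta <= pi / 2 ->
  sqm p = cos theta -> p.2 = sin theta -> gauge p = 1 /\ angle p = theta.
Proof.
move=> ht c s; have g1 : gauge p = 1.
  apply/eqP; rewrite -(@eqrXn2 _ 4) ?gauge_ge0 // (exprM _ 2 2) gauge_pow4.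
  by rewrite c s cos2Dsin2 expr1n.
by split => //; apply: angle_unique; rewrite // g1 ?oner_neq0 // expr1n mul1r.
Qed.

(** Converse of [cosine_relation] at common distance 1: [u] and [v] are the values that the
    displacement formulas force on z w^*, and the cosine equation says precisely that |u + iv|^2 =
    |z|^2 |w|^2. *)
Lemma pair_with_angles (t12 t23 t31 : R) :
  - (pi / 2) <= t12 <= pi / 2 -> - (pi / 2) <= t23 <= pi / 2 ->
  - (pi / 2) <= t31 <= pi / 2 ->
  cos (t31 + t12) + cos (t12 + t23) + cos (t23 + t31) = 3 / 2 ->
  exists x y, [/\ gauge x = 1 /\ angle x = t12, gauge y = 1 /\ angle y = - t31 &
    gauge (displacement x y) = 1 /\ angle (displacement x y) = t23].
Proof.
move=> h1 h2 h3; rewrite !cosD => e.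
have c1 := cos2Dsin2 t12; have c2 := cos2Dsin2 t23; have c3 := cos2Dsin2 t31.
pose u := (cos t12 + cos t31 - cos t23) / 2.
pose v := (- sin t31 - sin t12 - sin t23) / 2.
have muv : Normc.normc (u +i* v)%C ^+ 2 = cos t12 * cos t31.
  by rewrite normc_sqr /= /u /v; nra.
have [z [w [zE wE zw]]] :=
  product_conj_surj (cos_ge0_pihalf h1) (cos_ge0_pihalf h3) muv.
exists (z, sin t12), (w, - sin t31); split; apply: unit_polar => //.
- by lra.
- by rewrite cosN.
- by rewrite sinN.
- by rewrite sqm_displacement /= zw /sqm zE wE /= /u; lra.
- by rewrite snd_displacement /= zw /= /v; lra.
Qed.

Definition triple_angles P : R * R * R :=
  let: (p1, p2, p3) := P in
  let t12 := angle (displacement p1 p2) in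
  let t23 := angle (displacement p2 p3) in
  let t31 := angle (displacement p3 p1) in
  (t31 + t12, t12 + t23, t23 + t31).

Lemma triple_angles_diag_act (g : heis R -> heis R) P : similarity g ->
  triple_angles (diag_act g P) = triple_angles P.
Proof.
case: P => -[p1 p2] p3 /similarity_displacement[r _ hr] /=.
by rewrite !(hr _ _).2.
Qed.

(** Replaces a triple by the pair of displacements from its first point, the form used by
    [cosine_relation] and [pair_similar]. *)
Lemma equidistant_pair p1 p2 p3 : equidistant_triples (p1, p2, p3) ->
  let x := displacement p1 p2 in let y := displacement p1 p3 in
  [/\ gauge x != 0, gauge y = gauge x, gauge (displacement x y) = gauge x &
   triple_angles (p1, p2, p3) = (- angle y + angle x,
     angle x + angle (displacement x y), angle (displacement x y) - angle y)].
Proof.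
move=> [n12 _ _ e1 e2] x y; rewrite displacement_displacement.
have gx : gauge x != 0.
  by apply/eqP => /gauge_eq0/displacement_eq1/esym.
have gy : gauge y = gauge x.
  rewrite /x -/(kdist p1 p2) e1 e2 /kdist -/(displacement _ _).
  by rewrite displacementC gauge_inv.
split => //.
by rewrite /= (displacementC p1 p3) angle_inv // gy.
Qed.

Lemma triple_angles_hypersurface P :
  equidistant_triples P -> hypersurface R (triple_angles P).
Proof.
case: P => -[p1 p2] p3 /equidistant_pair[g0 gy gd ->].
have /= e := cosine_relation g0 gy gd.
set x := displacement p1 p2 in e *; set y := displacement p1 p3 in e *.
have := angle_range x; have := angle_range y.
have := angle_range (displacement x y).
(* Any two of the cosines sum to at most 2, so the third is at least -1/2; the sums of angles lie in
   [-pi, pi], so [cos_geNhalf] applies. *)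
have := cos_le1 (- angle y + angle x).
have := cos_le1 (angle x + angle (displacement x y)).
have := cos_le1 (angle (displacement x y) - angle y).
by move=> ? ? ? ? ? ?; split => //; apply: cos_geNhalf; lra.
Qed.

Lemma triple_angles_inj P Q : equidistant_triples P -> equidistant_triples Q ->
  triple_angles P = triple_angles Q ->
  exists2 g, similarity g & Q = diag_act g P.
Proof.
case: P Q => -[p1 p2] p3 [[q1 q2] q3] /equidistant_pair[gx gy gd ->].
move=> /equidistant_pair[gx' gy' gd' ->].
set x := displacement p1 p2 in gx gy gd *.
set y := displacement p1 p3 in gy gd *.
set x' := displacement q1 q2 in gx' gy' gd' *.
set y' := displacement q1 q3 in gy' gd' *.
move=> [e1 e2 e3].
(* Equal pairwise sums give equal angles by linear algebra. *)
have [|||r [phi [r0 xE yE]]] := pair_similar gx gy gd gx' gy' gd'.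
- lra.
- lra.
- lra.
(* Move p1 to the identity, dilate and rotate there, then move the identity to q1. *)
exists (translation q1 \o
  (rotation phi \o (dilation r \o translation (hinv p1)))).
  apply: sim_comp; first exact: sim_translation.
  apply: sim_comp; first exact: sim_rotation.
  by apply: sim_comp; [exact: sim_dilation|exact: sim_translation].
rewrite /= /translation -/(displacement p1 p1) -/(displacement p1 p2).
rewrite -/(displacement p1 p3).
rewrite -/x -/y -xE -yE !displacementK /displacement hmulVp; congr (_, _, _).
case: q1 {gx' gy' gd' x' y' e1 e2 e3 xE yE} => -[a b] t.
by rewrite /hmul /rotation /dilation /hone /=;
  congr (_, _); [congr (_ +i* _)%C|]; ring.
Qed.

Lemma triple_angles_surj (abc : R * R * R) : hypersurface R abc ->
  exists2 P, equidistant_triples P & triple_angles P = abc.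
Proof.
case: abc => -[a b] c [/andP[a1 a2] /andP[b1 b2] /andP[c1 c2] e].
(* Cosine is even, so sign changes preserve the equation and the box. The six bounds place a + b - c
   and its two analogues in [-pi, pi]. *)
have h1 : a + b + - c <= pi.
  by apply: hypersurface_sum; rewrite ?cosN //; lra.
have h2 : a + - b + c <= pi.
  by apply: hypersurface_sum; rewrite ?cosN //; lra.
have h3 : - a + b + c <= pi.
  by apply: hypersurface_sum; rewrite ?cosN //; lra.
have h1' : - a + - b + c <= pi.
  by apply: hypersurface_sum; rewrite ?cosN //; lra.
have h2' : - a + b + - c <= pi.
  by apply: hypersurface_sum; rewrite ?cosN //; lra.
have h3' : a + - b + - c <= pi.
  by apply: hypersurface_sum; rewrite ?cosN //; lra.
have [||||x [y [[gx ax] [gy ay] [gd ad]]]] :=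
  @pair_with_angles ((a + b - c) / 2) ((b + c - a) / 2) ((c + a - b) / 2).
- lra.
- lra.
- lra.
- by rewrite -e; congr (cos _ + cos _ + cos _); lra.
have neq p q : gauge (displacement p q) = 1 -> p <> q.
  move=> + pq; rewrite pq /displacement hmulVp => g1.
  by have := gauge_pow4 (hone R); rewrite g1 sqmE /=; lra.
have gy' : gauge (displacement y (hone R)) = 1.
  by rewrite displacementC displacement0 gauge_inv.
have gx' : gauge (displacement (hone R) x) = 1 by rewrite displacement0.
(* The triple is normalized to start at the identity and to have common distance 1. *)
exists (hone R, x, y).
  split; [exact: neq|exact: neq|exact: neq| |].
    by rewrite /kdist -!/(displacement _ _) gx' gd.
  by rewrite /kdist -!/(displacement _ _) gy' gd.
rewrite /= (displacementC (hone R) y) !displacement0 angle_inv ?gy ?oner_neq0 //.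
by rewrite ax ay ad; congr (_, _, _); lra.
Qed.

End EquidistantTriples.

(** * The bijection from orbits to the hypersurface *)

Theorem theorem1p1 (R : realType) :
  exists f : set (triple R) -> (R * R * R)%type,
    set_bij (configuration_space R) (hypersurface R) f.
Proof.
(* Default value for [xget], which picks a representative of each orbit. *)
pose P0 : triple R := (hone R, hone R, hone R).
exists (fun O => triple_angles (xget P0 O)).
(* The orbit contains P, so [xget] returns an element of it, and invariance of the angles makes the
   choice irrelevant. *)
have fE P : triple_angles (xget P0 (orbit_of P)) = triple_angles P.
  have [g simg ->] : orbit_of P (xget P0 (orbit_of P)).
    apply: (@xgetPex _ P0); exists P; exists (translation (hone R)).
      exact: sim_translation.
    have tE p : translation (hone R) p = p.
      case: p => -[x y] t; rewrite /translation /hmul /hone /=.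
      by congr (_, _); [congr (_ +i* _)%C|]; ring.
    by case: P => -[p1 p2] p3; rewrite /= !tE.
  exact: triple_angles_diag_act.
split.
- by move=> _ [P eP <-] /=; rewrite fE; exact: triple_angles_hypersurface.
(* Composition with the similarity from P to Q gives one inclusion; exchanging P and Q gives the
   other, without inverting similarities. *)
- have orbit_sub P Q : equidistant_triples P -> equidistant_triples Q ->
      triple_angles P = triple_angles Q -> orbit_of Q `<=` orbit_of P.
    move=> eP eQ e _ [h simh ->]; have [g simg ->] := triple_angles_inj eP eQ e.
    by exists (h \o g); [exact: sim_comp|case: P {eP e} => -[]].
  move=> _ _ /set_mem[P eP <-] /set_mem[Q eQ <-]; rewrite !fE => e.
  by apply/seteqP; split; apply: orbit_sub.
- move=> abc /triple_angles_surj[P eP <-].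
  by exists (orbit_of P); [exists P|rewrite fE].
Qed.
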